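(* Let $G$ be a connected graph with at least $4$ vertices. Then $G$ is a contact graph of rectangles (i.e. admits a rectangular layout) if and only if $G$ has a planar, weak, closed rectangle of influence drawing.
   Context: A (strong) rectangular layout of $G=(V,E)$ is a set of axis-parallel rectangles with pairwise disjoint interiors, in bijection $\mathcal{R}$ with $V$, such that for distinct $u,v$ the boundaries of $\mathcal{R}(u)$ and $\mathcal{R}(v)$ share a segment of positive length if and only if $\{u,v\}\in E$. A weak closed rectangle of influence drawing of $G$ is a straight-line drawing of $G$ (vertices at distinct points, edges as segments) such that for every edge $\{u,v\}$, the closed axis-parallel rectangle having $u$ and $v$ as opposite corners (including its boundary; possibly degenerate) contains no other vertex. It is planar if no two edges cross. Throughout the paper, graphs are assumed connected with at least $4$ vertices. *)

(* Defs.v *)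
From mathcomp Require Export all_boot all_order all_algebra.
From mathcomp Require Export boolp classical_sets reals.
Set Implicit Arguments.
Unset Strict Implicit.
Unset Printing Implicit Defensive.
Import Order.TTheory GRing.Theory Num.Theory.
Local Open Scope ring_scope.
Local Open Scope classical_set_scope.

Section Geometry.
Variable R : realType.
Implicit Types p q : R * R.

Definition segment p q : set (R * R) :=
  [set ((1 - t) * p.1 + t * q.1, (1 - t) * p.2 + t * q.2)
    | t in [set t : R | 0 <= t <= 1]].

Record rectangle := Rectangle {
  xmin : R; xmax : R; ymin : R; ymax : R;
  xmin_lt_xmax : xmin < xmax;
  ymin_lt_ymax : ymin < ymax }.

Implicit Types r s : rectangle.

Definition rect_closed r : set (R * R) :=
  [set z | xmin r <= z.1 <= xmax r /\ ymin r <= z.2 <= ymax r].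

Definition rect_interior r : set (R * R) :=
  [set z | xmin r < z.1 < xmax r /\ ymin r < z.2 < ymax r].

Definition rect_boundary r : set (R * R) := rect_closed r `\` rect_interior r.

Definition share_segment r s : Prop :=
  exists p q, p <> q /\ segment p q `<=` rect_boundary r `&` rect_boundary s.

Definition influence_rect p q : set (R * R) :=
  [set z | Num.min p.1 q.1 <= z.1 <= Num.max p.1 q.1
        /\ Num.min p.2 q.2 <= z.2 <= Num.max p.2 q.2].

End Geometry.

Section Graphs.
Variables (R : realType) (V : finType) (E : rel V).

(* [rho] is automatically injective: rectangles have nonempty interior. *)
Definition rectangular_layout (rho : V -> rectangle R) : Prop :=
  (forall u v, u <> v ->
     rect_interior (rho u) `&` rect_interior (rho v) = set0) /\
  (forall u v, u <> v -> (share_segment (rho u) (rho v) <-> E u v)).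

(* A straight-line drawing is determined by the positions of its vertices. *)
Definition weak_closed_RI_drawing (pos : V -> R * R) : Prop :=
  injective pos /\
  (forall u v, E u v ->
     forall w, influence_rect (pos u) (pos v) (pos w) -> w = u \/ w = v).

(* Distinct edges meet at most in the image of a common end vertex. *)
Definition planar_drawing (pos : V -> R * R) : Prop :=
  forall u v x y, E u v -> E x y ->
    [set u; v] <> [set x; y] :> set V ->
    segment (pos u) (pos v) `&` segment (pos x) (pos y)
      `<=` pos @` ([set u; v] `&` [set x; y]).

Definition rectangle_contact_graph : Prop :=
  exists rho : V -> rectangle R, rectangular_layout rho.

Definition has_planar_weak_closed_RI_drawing : Prop :=
  exists pos : V -> R * R, weak_closed_RI_drawing pos /\ planar_drawing pos.

End Graphs.

(* Main.v *)
Require Import Defs.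
From mathcomp Require Import all_boot all_order all_algebra.
From mathcomp Require Import reals.
From mathcomp Require Import ring lra.

(* Both sides are equivalent to the existence of injective coordinates on the
   vertices such that the box spanned by an edge contains no other vertex and no two
   boxes of edges pierce each other. A drawing yields them by breaking ties, and such
   coordinates form a planar drawing as they stand. From a layout they are obtained as
   linear extensions of the relations "left of or above" and "left of or below", which
   are acyclic on interior-disjoint rectangles.

   To build rectangles, first add edges as long as the boxes stay compatible. The
   horizontal extent of a vertex is read off from vertical lines: maximal descending
   chains of vertices whose consecutive members could be joined by an edge. No edge
   jumps over such a line, so "beyond the line" is an up-closed set of vertical sides,
   and counting up-closed sets puts the sides in order. Vertical extents come from the
   mirror image. By maximality, vertices that are not adjacent have disjoint closed
   rectangles, and the contacts of the added edges can be cut by an infinitesimal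
   shift of sides. *)

Set Implicit Arguments.
Unset Strict Implicit.
Unset Printing Implicit Defensive.
Import Order.TTheory GRing.Theory Num.Theory.
Local Open Scope ring_scope.

(** * Orders and ranks *)

Lemma intervals_overlap (disp : Order.disp_t) (T : orderType disp) (a b c d : T) :
    (a < b -> c < d -> a < d -> c < b ->
  exists x y, [/\ x < y, a <= x, c <= x, y <= b & y <= d])%O.
Proof.
move=> ab cd ad cb; exists (Order.max a c), (Order.min b d).
by rewrite !le_max !ge_min !lexx !orbT lt_min !gt_max ab cb ad cd.
Qed.

Lemma rank_embedding (R : realDomainType) (I : finType) (d : Order.disp_t)
    (T : orderType d) (x : I -> T) :
  exists y : I -> R, forall i j, (y i <= y j) = (x i <= x j)%O.
Proof.
pose below i := [set j | (x j < x i)%O]%SET.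
exists (fun i => #|below i|%:R) => i j; rewrite ler_nat.
have [xij|xji] := leP (x i) (x j).
  by apply/subset_leq_card/fintype.subsetP => k; rewrite !inE => /lt_le_trans; apply.
apply/negbTE; rewrite -ltnNge; apply/proper_card/properP; split.
  by apply/fintype.subsetP => k; rewrite !inE => /lt_trans; apply.
by exists j; rewrite !inE ?ltxx.
Qed.

Lemma injective_rank (R : realDomainType) (I : finType) (d : Order.disp_t)
    (T : orderType d) (x : I -> T) :
  exists2 y : I -> R, injective y & forall i j, (x i < x j)%O -> y i < y j.
Proof.
have [y yE] := rank_embedding R (fun i => (x i, enum_rank i) : T *l 'I__).
exists y => [i j yij|i j xij].
  have : (y i <= y j) && (y j <= y i) by rewrite yij lexx.
  by rewrite !yE -eq_le xpair_eqE => /andP[_ /eqP/enum_rank_inj].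
by rewrite ltNge yE lexi_pair leNgt xij.
Qed.

Definition up_closed (T : finType) (W : rel T) (S : {set T}) : bool :=
  [forall x in S, forall y, W x y ==> (y \in S)].

Lemma up_closedP (T : finType) (W : rel T) (S : {set T}) :
  reflect (forall x y, W x y -> x \in S -> y \in S) (up_closed W S).
Proof.
apply: (iffP forall_inP) => [closedS x y Wxy Sx|closedS x Sx].
  by have /forallP/(_ y)/implyP := closedS x Sx; apply.
by apply/forallP => y; apply/implyP => /closedS; apply.
Qed.

Lemma up_closed_rank (R : realDomainType) (T : finType) (W : rel T) :
  exists y : T -> R,
    (forall i j, W i j -> y i <= y j) /\
    (forall i j S, W i j -> up_closed W S -> i \notin S -> j \in S -> y i < y j).
Proof.
pose closed_at i := [set S | up_closed W S & i \in S]%SET.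
have sub i j : W i j -> closed_at i \subset closed_at j.
  move=> Wij; apply/fintype.subsetP => S; rewrite !inE => /andP[closedS iS].
  by rewrite closedS; apply: (up_closedP _ _ closedS) iS.
exists (fun i => #|closed_at i|%:R); split=> [i j Wij|i j S Wij closedS iS jS].
  by rewrite ler_nat subset_leq_card ?sub.
rewrite ltr_nat; apply/proper_card/properP; split; first exact: sub.
by exists S; rewrite !inE closedS // (negPf iS).
Qed.

Lemma linear_extension (R : realDomainType) (V : finType) (D : rel V) :
    (forall S : {set V}, S != finset.set0 ->
       exists2 u, u \in S & {in S, forall v, ~~ D v u}) ->
  exists2 f : V -> R, injective f & forall u v, D u v -> f u < f v.
Proof.
move=> minD.
suff sort (S : {set V}) : exists2 s : seq V, s =i S &
    {in S &, forall u v, D u v -> (index u s < index v s)%N}.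
  have [s sE sorted_s] := sort [set: V]%SET.
  exists (fun u => (index u s)%:R) => [u v /eqP|u v Duv].
    by rewrite eqr_nat => /eqP; apply: (index_inj u); rewrite sE inE.
  by rewrite ltr_nat sorted_s ?inE.
have [n] := ubnP #|S|; elim: n S => // n IHn S ltSn.
have [->|S0] := eqVneq S finset.set0.
  by exists [::] => [u|u v]; rewrite inE.
have [u uS minu] := minD S S0; have [|s sE sorted_s] := IHn (S :\ u)%SET.
  by rewrite (cardsD1 u S) uS in ltSn.
exists (u :: s) => [v|v w vS wS Dvw].
  by rewrite inE sE !inE; case: eqVneq => [->|].
have wu : w != u by apply: contraTneq Dvw => ->; exact: minu.
rewrite /= [u == w]eq_sym (negPf wu); case: eqVneq => // uv.
by rewrite ltnS; apply: sorted_s => //; rewrite !inE ?wu ?wS // eq_sym uv vS.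
Qed.

(** * Boxes in the plane *)

Section Points.
Variable R : realDomainType.
Implicit Types (a b c : R) (p q x y z : R * R).

Definition ascending p q := (p.1 < q.1) && (p.2 < q.2).
Definition descending p q := (p.1 < q.1) && (q.2 < p.2).

Definition between a b c := (a < b < c) || (c < b < a).

Lemma betweenC a b c : between a b c = between c b a.
Proof. exact: orbC. Qed.

Lemma betweenN a b c : between (- a) (- b) (- c) = between a b c.
Proof. by rewrite /between !ltrN2 orbC ![(b < _) && _]andbC. Qed.

Definition in_box p q z := between p.1 z.1 q.1 && between p.2 z.2 q.2.

(* The box of [p], [q] is the wide one, that of [x], [y] the tall one. *)
Definition pierces p q x y :=
  [&& between p.1 x.1 q.1, between p.1 y.1 q.1,
      between x.2 p.2 y.2 & between x.2 q.2 y.2].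

Definition crossing p q x y := pierces p q x y || pierces x y p q.

Definition mirror p := (- p.1, p.2).

Lemma ascending_trans : transitive ascending.
Proof. by move=> q p z; rewrite /ascending; lra. Qed.

Lemma descending_trans : transitive descending.
Proof. by move=> q p z; rewrite /descending; lra. Qed.

Lemma in_boxC p q z : in_box p q z = in_box q p z.
Proof. by rewrite /in_box !(betweenC p.1) !(betweenC p.2). Qed.

Lemma ascending_in_box p q z : ascending p z -> ascending z q -> in_box p q z.
Proof. by rewrite /ascending /in_box /between; lra. Qed.

Lemma descending_in_box p q z : descending p z -> descending z q -> in_box p q z.
Proof. by rewrite /descending /in_box /between; lra. Qed.

Lemma in_boxP p q z : in_box p q z ->
  [\/ ascending p z /\ ascending z q, ascending q z /\ ascending z p,
      descending p z /\ descending z q | descending q z /\ descending z p].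
Proof.
rewrite /ascending /descending.
case/andP=> /orP[]/andP[-> ->] /orP[]/andP[-> ->];
  by [apply: Or41|apply: Or42|apply: Or43|apply: Or44].
Qed.

Lemma in_box_descending p q z : descending p q ->
  in_box p q z = descending p z && descending z q.
Proof. by rewrite /in_box /between /descending; lra. Qed.

Lemma piercesCl p q x y : pierces p q x y = pierces q p x y.
Proof. by rewrite /pierces !(betweenC p.1) [between x.2 p.2 _ && _]andbC. Qed.

Lemma piercesCr p q x y : pierces p q x y = pierces p q y x.
Proof. by rewrite /pierces !(betweenC x.2) andbCA. Qed.

(* [p], [q], [x], [y] are the left, right, lower and upper ends. *)
Definition corners p q x y :=
  [&& descending p x, ascending p y, ascending x q & descending y q].

Lemma corners_pierces p q x y : corners p q x y -> pierces p q x y.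
Proof.
by case/and4P; rewrite /ascending /descending => px py xq yq;
   apply/and4P; split; apply/orP; left; lra.
Qed.

Lemma piercesP p q x y : pierces p q x y ->
  [\/ corners p q x y, corners p q y x, corners q p x y | corners q p y x].
Proof.
rewrite /pierces /between /corners /ascending /descending.
have [lt_pq|lt_qp|eq_pq] := ltgtP p.1 q.1; last by lra.
  have [lt_xy|lt_yx|eq_xy] := ltgtP x.2 y.2; last by lra.
    by move=> ?; apply: Or41; lra.
  by move=> ?; apply: Or42; lra.
have [lt_xy|lt_yx|eq_xy] := ltgtP x.2 y.2; last by lra.
  by move=> ?; apply: Or43; lra.
by move=> ?; apply: Or44; lra.
Qed.

Lemma crossingC p q x y : crossing p q x y = crossing x y p q.
Proof. exact: orbC. Qed.

Lemma crossingCl p q x y : crossing p q x y = crossing q p x y.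
Proof. by rewrite /crossing piercesCl [pierces x y p q]piercesCr. Qed.

Lemma crossing_refl p q : crossing p q p q = false.
Proof. by rewrite /crossing /pierces /between !ltxx !andbF. Qed.

Lemma ascending_mirror p q : ascending (mirror p) (mirror q) = descending q p.
Proof. by rewrite /ascending /descending ltrN2. Qed.

Lemma descending_mirror p q : descending (mirror p) (mirror q) = ascending q p.
Proof. by rewrite /ascending /descending ltrN2. Qed.

Lemma in_box_mirror p q z : in_box (mirror p) (mirror q) (mirror z) = in_box p q z.
Proof. by rewrite /in_box betweenN. Qed.

Lemma crossing_mirror p q x y :
  crossing (mirror p) (mirror q) (mirror x) (mirror y) = crossing p q x y.
Proof. by rewrite /crossing /pierces !betweenN. Qed.

Lemma descending_swap p q : descending (swap_pair p) (swap_pair q) = descending q p.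
Proof. exact: andbC. Qed.

Lemma in_box_swap p q z :
  in_box (swap_pair p) (swap_pair q) (swap_pair z) = in_box p q z.
Proof. exact: andbC. Qed.

Lemma crossing_swap p q x y :
  crossing (swap_pair p) (swap_pair q) (swap_pair x) (swap_pair y) = crossing p q x y.
Proof.
by rewrite /crossing orbC; congr (_ || _); rewrite /pierces andbA andbC -andbA.
Qed.

End Points.

Arguments ascending {R} p q.
Arguments descending {R} p q.
Arguments mirror {R} p.

Section Noncrossing.
Variables (R : realDomainType) (V : finType).
Implicit Types (pos : V -> R * R) (E : rel V) (u v w x y : V).

Definition general_position pos :=
  injective (fun v => (pos v).1) /\ injective (fun v => (pos v).2).

Definition admissible pos E u v :=
  (forall w, ~~ in_box (pos u) (pos v) (pos w)) /\
  (forall x y, E x y -> ~~ crossing (pos u) (pos v) (pos x) (pos y)).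

Definition noncrossing pos E := forall u v, E u v -> admissible pos E u v.

Variables (pos : V -> R * R) (E : rel V).

Lemma admissibleC u v : admissible pos E u v -> admissible pos E v u.
Proof.
case=> box cross; split=> [w|x y Exy]; first by rewrite in_boxC.
by rewrite crossingCl cross.
Qed.

Lemma noncrossing_corners : symmetric E ->
    (forall u v w, E u v -> ~~ in_box (pos u) (pos v) (pos w)) ->
    (forall u v x y, E u v -> E x y -> ~~ corners (pos u) (pos v) (pos x) (pos y)) ->
  noncrossing pos E.
Proof.
move=> E_sym box cross u v Euv; split=> [w|x y Exy]; first exact: box.
have [Evu Eyx] : E v u /\ E y x by split; rewrite E_sym.
by apply/negP => /orP[] /piercesP[]; apply/negP/cross.
Qed.

Lemma admissible_comp (h : R * R -> R * R) u v :
    (forall p q z, in_box (h p) (h q) (h z) = in_box p q z) ->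
    (forall p q p' q', crossing (h p) (h q) (h p') (h q') = crossing p q p' q') ->
  admissible (h \o pos) E u v <-> admissible pos E u v.
Proof.
move=> h_box h_crossing; rewrite /admissible /=.
split=> -[box cross]; split=> [w|x y Exy].
- by rewrite -h_box.
- by rewrite -h_crossing cross.
- by rewrite h_box.
- by rewrite h_crossing cross.
Qed.

Lemma admissible_mirror u v :
  admissible (mirror \o pos) E u v <-> admissible pos E u v.
Proof. by apply: admissible_comp; [exact: in_box_mirror|exact: crossing_mirror]. Qed.

Lemma admissible_swap u v :
  admissible (swap_pair \o pos) E u v <-> admissible pos E u v.
Proof. by apply: admissible_comp; [exact: in_box_swap|exact: crossing_swap]. Qed.

Lemma noncrossing_mirror : noncrossing pos E -> noncrossing (mirror \o pos) E.
Proof. by move=> ncE u v Euv; apply/admissible_mirror/ncE. Qed.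

Lemma noncrossing_swap : noncrossing pos E -> noncrossing (swap_pair \o pos) E.
Proof. by move=> ncE u v Euv; apply/admissible_swap/ncE. Qed.

Hypothesis gpos : general_position pos.

Lemma general_position_mirror : general_position (mirror \o pos).
Proof. by split=> u v; [move=> /oppr_inj/gpos.1|move=> /gpos.2]. Qed.

Lemma general_position_swap : general_position (swap_pair \o pos).
Proof. by split; [exact: gpos.2|exact: gpos.1]. Qed.

Lemma coordinates_neq u v : u != v ->
  ((pos u).1 != (pos v).1) && ((pos u).2 != (pos v).2).
Proof. by move=> uv; rewrite (inj_eq gpos.1) (inj_eq gpos.2) uv. Qed.

Lemma general_position_cases u v : u != v ->
  [\/ ascending (pos u) (pos v), ascending (pos v) (pos u),
      descending (pos u) (pos v) | descending (pos v) (pos u)].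
Proof.
move/coordinates_neq; rewrite /ascending /descending.
by case: ltgtP => // _; case: ltgtP => // _;
   by [apply: Or41|apply: Or42|apply: Or43|apply: Or44].
Qed.

End Noncrossing.

(** * Links and lines *)

Lemma path_exit (T : eqType) (e : rel T) (P : pred T) x s :
    path e x s -> P x -> ~~ all P s ->
  exists a b, [/\ a \in x :: s, b \in s, e a b, P a & ~~ P b].
Proof.
elim: s x => // y s IHs x /= /andP[exy pathy] Px.
have [Py|nPy _] := boolP (P y); last by exists x, y; rewrite !mem_head.
move=> /(IHs y pathy Py)[a [b [ays bs eab Pa nPb]]].
by exists a, b; rewrite [a \in _]inE ays orbT inE bs orbT.
Qed.

Section Links.
Variables (R : realDomainType) (V : finType) (pos : V -> R * R) (E : rel V).

Local Notation asc u v := (ascending (pos u) (pos v)).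
Local Notation desc u v := (descending (pos u) (pos v)).
Local Notation box u v w := (in_box (pos u) (pos v) (pos w)).

Definition link u v := desc u v && `[< admissible pos E u v >].

Lemma linkP u v : reflect (desc u v /\ admissible pos E u v) (link u v).
Proof. by apply: (iffP andP) => -[uv /asboolP adm]. Qed.

Lemma link_desc u v : link u v -> desc u v.
Proof. by case/linkP. Qed.

Definition overpassed u v :=
  [exists p, exists q, E p q && corners (pos p) (pos q) (pos v) (pos u)].

Definition exposed u v :=
  [&& desc u v, [forall w, ~~ box u v w] & ~~ overpassed u v].

Lemma overpassedP u v :
  reflect (exists p q, E p q /\ corners (pos p) (pos q) (pos v) (pos u)) (overpassed u v).
Proof.
by apply: (iffP existsP) => -[p]; [move=> /existsP[q /andP[]]|move=> [q []]];
   exists p; [exists q|apply/existsP; exists q; apply/andP].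
Qed.

Hypotheses (gpos : general_position pos) (E_sym : symmetric E).
Hypothesis ncE : noncrossing pos E.

Lemma exposed_link u v : exposed u v ->
    (forall p q, E p q -> ~~ corners (pos u) (pos v) (pos p) (pos q)) ->
  link u v.
Proof.
case/and3P=> uv /forallP box_uv /overpassedP nover no_tall.
have [lt_uv1 lt_vu2] := andP uv.
apply/linkP; split=> //; split=> // p q Epq; apply/negP => /orP[]/piercesP[] pierced.
- by move: pierced; apply/negP/no_tall.
- by move: pierced; apply/negP/no_tall; rewrite E_sym.
- by move: pierced; rewrite /corners /ascending /descending; lra.
- by move: pierced; rewrite /corners /ascending /descending; lra.
- by move: pierced; rewrite /corners /ascending /descending; lra.
- by apply: nover; exists p, q.
- by move: pierced; rewrite /corners /ascending /descending; lra.
- by apply: nover; exists q, p; rewrite E_sym.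
Qed.

Lemma lowest_exposed v w : desc w v -> exists u, exposed u v.
Proof.
move=> wv.
have [u uv lowest] := arg_minP (fun z => (pos z).2) (P := fun z => desc z v) wv.
exists u; apply/and3P; split=> //.
  apply/forallP => z; rewrite in_box_descending //; apply/negP => /andP[uz zv].
  by have := lowest z zv; move: uz; rewrite /descending; lra.
apply/overpassedP => -[p [q [_ /and4P[pv pu _ _]]]].
by have := lowest p pv; move: pu; rewrite /ascending; lra.
Qed.

(* If an edge passing to the right of the highest exposed vertex cut it off from
   [v], the lowest vertex further right would be cut off by an edge passing below
   it, and these two edges would cross. *)
Lemma uplink v w : desc w v -> exists u, link u v.
Proof.
move=> /lowest_exposed[u0 exp_u0].
have [u exp_u highest] := arg_maxP (fun z => (pos z).2) (P := exposed^~ v) exp_u0.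
exists u; apply: exposed_link => // p q Epq; apply/negP => /and4P[up uq pv qv].
have [uv /forallP box_uv _] := and3P exp_u.
have lt_uq : (pos u).1 < (pos q).1 by case/andP: uq.
have [t /andP[tv lt_ut] lowest] := arg_minP (fun z => (pos z).2)
  (P := fun z => desc z v && ((pos u).1 < (pos z).1)) (introT andP (conj qv lt_uq)).
have ut : asc u t.
  have neq_ut : u != t by apply: contraTneq lt_ut => ->; rewrite ltxx.
  have := coordinates_neq gpos neq_ut; have := box_uv t; rewrite in_box_descending // tv.
  by move: lt_ut; rewrite /ascending /descending; lra.
have box_tv z : ~~ box t v z.
  rewrite in_box_descending //; apply/negP => /andP[tz zv].
  have /lowest : desc z v && ((pos u).1 < (pos z).1).
    by rewrite zv; move: tz lt_ut; rewrite /descending; lra.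
  by move: tz; rewrite /descending; lra.
have /overpassedP[p' [q' [Epq' /and4P[pv' pt' vq' tq']]]] : overpassed t v.
  apply: contraT => not_over; have /highest : exposed t v.
    by apply/and3P; split=> //; apply/forallP.
  by move: ut; rewrite /ascending /=; lra.
have le_pu' : (pos p').1 <= (pos u).1.
  rewrite leNgt; apply/negP => lt_up'.
  have /lowest : desc p' v && ((pos u).1 < (pos p').1) by rewrite pv'.
  by move: pt'; rewrite /ascending /=; lra.
have le_tq : (pos t).2 <= (pos q).2 by apply: lowest; rewrite qv.
have [_ /(_ p q Epq)/negP] := ncE Epq'; apply; apply/orP; left.
move: up uq pv qv tv pv' pt' vq' tq'; rewrite /ascending /descending.
by move=> *; apply/corners_pierces/and4P; rewrite /ascending /descending; split; lra.
Qed.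

End Links.

Section Lines.
Variables (R : realDomainType) (V : finType) (pos : V -> R * R) (E : rel V).
Hypotheses (gpos : general_position pos) (E_sym : symmetric E).
Hypothesis ncE : noncrossing pos E.

Local Notation asc u v := (ascending (pos u) (pos v)).
Local Notation desc u v := (descending (pos u) (pos v)).
Local Notation box u v w := (in_box (pos u) (pos v) (pos w)).
Local Notation link := (link pos E).

Lemma downlink v w : desc v w -> exists u, link v u.
Proof.
rewrite -descending_swap => vw.
have [u /linkP[]] := uplink (general_position_swap gpos) E_sym (noncrossing_swap ncE) vw.
rewrite descending_swap => uv /admissible_swap/admissibleC adm.
by exists u; apply/linkP.
Qed.

Lemma link_sorted_pairwise s : sorted link s -> pairwise (relpre pos descending) s.
Proof.
rewrite -(sorted_pairwise (relpre_trans (@descending_trans R))).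
by apply: sub_sorted => u v; exact: link_desc.
Qed.

Lemma link_sorted_uniq s : sorted link s -> uniq s.
Proof.
move/link_sorted_pairwise; apply: pairwise_uniq => u.
by rewrite /= /descending ltxx.
Qed.

(* The vertices met by a vertical line of the layout, from top to bottom. *)
Definition line (s : seq V) :=
  [/\ sorted link s, forall w, ~~ all (fun z => desc w z) s &
      forall w, ~~ all (fun z => desc z w) s].

Lemma link_path_extends s : s != [::] -> sorted link s ->
  line s \/ exists2 s', sorted link s' & size s' = (size s).+1 /\ {subset s <= s'}.
Proof.
move=> s0 sorted_s.
have [[w ws]|no_up] := pselect (exists w, all (fun z => desc w z) s).
  case: s s0 sorted_s ws => // x s _ sorted_s /andP[/(uplink gpos E_sym ncE)[u ux] _].
  right; exists [:: u, x & s]; first by rewrite /= ux.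
  by split=> // z zs; rewrite inE zs orbT.
have [[w sw]|no_down] := pselect (exists w, all (fun z => desc z w) s).
  case/lastP: s s0 sorted_s sw {no_up} => // s x _ sorted_s.
  rewrite all_rcons => /andP[/downlink[u xu] _].
  right; exists (rcons (rcons s x) u).
    by rewrite -[rcons _ u]cats1 cat_rcons sorted_cat_cons sorted_s /= xu.
  by split=> [|z zs]; rewrite ?size_rcons // mem_rcons inE zs orbT.
by left; split=> // w; apply/negP => ws; [apply: no_up|apply: no_down]; exists w.
Qed.

Lemma line_exists s : s != [::] -> sorted link s ->
  exists2 s', line s' & {subset s <= s'}.
Proof.
have [n] := ubnP (#|V| - size s); elim: n s => // n IHn s ltn s0 sorted_s.
have [line_s|[s' sorted_s' [size_s' ss']]] := link_path_extends s0 sorted_s.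
  by exists s.
have s'0 : s' != [::] by rewrite -size_eq0 size_s'.
have ltn' : (#|V| - size s' < n)%N.
  have le_s'V : (size s' <= #|V|)%N.
    by rewrite -(card_uniqP (link_sorted_uniq sorted_s')) max_card.
  by rewrite -ltnS; apply: leq_trans ltn; rewrite ltnS size_s' ltn_sub2l // -size_s'.
have [s'' line_s'' s's''] := IHn s' ltn' s'0 sorted_s'.
by exists s'' => // z /ss'/s's''.
Qed.

Section Line.
Variable s : seq V.
Hypothesis line_s : line s.

Let sorted_s : sorted link s.
Proof. by case: line_s. Qed.

Lemma line_total u v : u \in s -> v \in s -> u != v -> desc u v || desc v u.
Proof.
move=> us vs; have := link_sorted_pairwise sorted_s.
rewrite -(sorted_pairwise (relpre_trans (@descending_trans R))) => sorted_desc.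
have lt_index := sorted_ltn_index (relpre_trans (@descending_trans R)) sorted_desc.
case: (ltngtP (index u s) (index v s)) => [lt_uv _|lt_vu _|/(index_inj u us vs)->].
- by apply/orP; left; exact: lt_index.
- by apply/orP; right; exact: lt_index.
- by rewrite eqxx.
Qed.

Lemma line_not_asc u v : u \in s -> v \in s -> ~~ asc u v.
Proof.
move=> us vs; have [->|uv] := eqVneq u v; first by rewrite /ascending ltxx.
by have := line_total us vs uv; rewrite /ascending /descending; lra.
Qed.

Lemma line_exit (P : pred V) z z' : z \in s -> z' \in s -> P z -> ~~ P z' ->
    {in s &, forall u v, desc u v -> P v -> P u} ->
  exists u v, [/\ u \in s, v \in s, link u v, P u & ~~ P v].
Proof.
move=> zs z's Pz nPz' upP.
have [s1 [s2 def_s]] : exists s1 s2, s = s1 ++ z :: s2.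
  by case/splitPr: zs => s1 s2; exists s1, s2.
have [_ path_s2] : sorted link (rcons s1 z) /\ path link z s2.
  by apply/andP; rewrite -sorted_cat_cons -def_s.
have : ~~ all P s2.
  apply: contra nPz' => /allP P_s2; have := z's; rewrite def_s mem_cat inE.
  case/or3P=> [z's1|/eqP->//|/P_s2//]; apply: (upP _ z) => //.
  have := link_sorted_pairwise sorted_s; rewrite def_s pairwise_cat.
  by case/andP=> /allrelP/(_ _ _ z's1 (mem_head z s2)).
case/(path_exit path_s2 Pz) => u [v [us2 vs2 uv Pu nPv]].
by exists u, v; rewrite def_s !mem_cat us2 inE vs2 !orbT.
Qed.

Lemma line_side p : p \notin s -> exists2 z, z \in s & asc p z || asc z p.
Proof.
have [_ no_up no_down] := line_s.
move=> ps; apply: contrapT => no_side.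
have rel_p z : z \in s -> desc z p || desc p z.
  move=> zs; have zp : z != p by apply: contraNneq ps => <-.
  have [az|az|->|->] := general_position_cases gpos zp; rewrite ?orbT //;
    by case: no_side; exists z; rewrite // az ?orbT.
have /allPn[z zs /negPf nzp] := no_down p; have := rel_p z zs; rewrite nzp /= => pz.
have /allPn[z' z's /negPf npz'] := no_up p.
have z'p : desc z' p by have := rel_p z' z's; rewrite npz' orbF.
have [|u [v [us vs /linkP[_ [/(_ p)/negP no_box _]] up nvp]]] :=
    line_exit (P := fun z => desc z p) z's zs z'p (negbT nzp).
  by move=> u v _ _; exact: descending_trans.
by apply: no_box; apply: descending_in_box up _; have := rel_p v vs; rewrite (negPf nvp).
Qed.

Definition right_of p := has (fun z => asc z p) s.

Lemma right_of_asc p q : right_of p || (p \in s) -> asc p q -> right_of q.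
Proof.
move=> ps pq; apply/hasP; case/orP: ps => [/hasP[z zs zp]|ps]; last by exists p.
by exists z => //; exact: ascending_trans pq.
Qed.

Lemma not_right_of z : z \in s -> ~~ right_of z.
Proof. by move=> zs; apply/hasPn => z' /line_not_asc; apply. Qed.

End Line.

(* The possible positions of a vertex [z] on a line with [p] on its left and [q] on
   its right. *)
Definition lies_across p q z :=
  [\/ asc p z, desc z p | desc p z] /\ [\/ asc z q, desc z q | desc q z].

Lemma line_lies_across s p q z : line s ->
  right_of s q -> ~~ right_of s p -> p \notin s -> z \in s -> lies_across p q z.
Proof.
move=> line_s right_q nright_p ps zs; have /hasP[z' z's z'q] := right_q.
have zp : z != p by apply: contraNneq ps => <-.
have zq : z != q by apply: contraTneq right_q => <-; exact: not_right_of.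
have nasc_zp : ~~ asc z p by move/hasPn: nright_p; apply.
have nasc_qz : ~~ asc q z.
  by apply: contra (line_not_asc line_s z's zs); exact: ascending_trans z'q.
split.
  have := general_position_cases gpos zp; rewrite (negPf nasc_zp).
  by case=> //; [constructor 1|constructor 2|constructor 3].
have := general_position_cases gpos zq; rewrite (negPf nasc_qz).
by case=> //; [constructor 1|constructor 2|constructor 3].
Qed.

Definition over p q z := desc z p || desc z q.
Definition under p q z := desc p z || desc q z.

Lemma lies_across_under p q z :
  lies_across p q z -> ~~ box p q z -> ~~ over p q z -> under p q z.
Proof.
rewrite /under => -[p_z z_q] /negP nbox; rewrite negb_or => /andP[/negP nzp /negP nzq].
case: p_z z_q => // [pz|->//] [zq|//|->]; rewrite ?orbT //.
by case: nbox; exact: ascending_in_box.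
Qed.

Lemma over_opposite p q z z' : lies_across p q z -> lies_across p q z' ->
    ~~ box p q z -> ~~ box p q z' -> asc p z -> asc z' q -> ~~ asc z' z ->
  over p q z' = ~~ over p q z.
Proof.
move=> [_ z_q] [p_z' _] /negP nbox /negP nbox' pz z'q nz'z.
have -> : over p q z = desc z q.
  by move: pz; rewrite /over /ascending /descending; lra.
have -> : over p q z' = desc z' p.
  by move: z'q; rewrite /over /ascending /descending; lra.
case: z_q => [zq|z_q|z_q]; first by case: nbox; exact: ascending_in_box.
all: case: p_z' => [pz'|p_z'|p_z']; first by case: nbox'; exact: ascending_in_box.
all: by move: pz z'q nz'z z_q p_z'; rewrite /ascending /descending; lra.
Qed.

(* A link going down past an edge [p], [q] in this way would have [p] or [q] in its
   box, or cross it. *)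
Lemma no_link_past_edge a b p q : link a b -> E p q ->
    lies_across p q a -> lies_across p q b ->
    over p q a -> under p q b ->
  False.
Proof.
case/linkP=> ab [box_ab cross_ab] Epq [a_p a_q] [b_p b_q]; have [box_pq _] := ncE Epq.
have /negP box_ab_p := box_ab p; have /negP box_ab_q := box_ab q.
have /negP box_pq_a := box_pq a; have /negP box_pq_b := box_pq b.
have /negP no_cross := cross_ab p q Epq.
case/orP=> [ap|aq] /orP[pb|qb].
- exact/box_ab_p/(descending_in_box ap).
- have pb : asc p b.
    case: b_p => // [bp|pb]; last by case: box_ab_p; exact: descending_in_box pb.
    by case: box_pq_b; rewrite in_boxC; exact: descending_in_box bp.
  have aq : asc a q.
    case: a_q => // [aq|qa]; first by case: box_ab_q; exact: descending_in_box qb.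
    by case: box_pq_a; rewrite in_boxC; exact: descending_in_box ap.
  by apply: no_cross; apply/orP; left; apply/corners_pierces/and4P.
- have pa : asc p a.
    case: a_p => // [ap|pa]; first by case: box_ab_p; exact: descending_in_box pb.
    by case: box_pq_a; exact: descending_in_box aq.
  have bq : asc b q.
    case: b_q => // [bq|qb]; last by case: box_ab_q; exact: descending_in_box qb.
    by case: box_pq_b; exact: descending_in_box bq.
  by apply: no_cross; apply/orP; right; rewrite piercesCr; apply/corners_pierces/and4P.
- exact/box_ab_q/(descending_in_box aq).
Qed.

Lemma line_separates s p q : line s -> E p q ->
  right_of s q -> right_of s p || (p \in s).
Proof.
move=> line_s Epq right_q; apply: contraT; rewrite negb_or => /andP[nright_p ps].
have [box_pq _] := ncE Epq; have /hasP[z' z's z'q] := right_q.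
have rel z (zs : z \in s) := line_lies_across line_s right_q nright_p ps zs.
have [z zs pz] : exists2 z, z \in s & asc p z.
  have [z zs /orP[pz|zp]] := line_side line_s ps; first by exists z.
  by case/hasP: nright_p; exists z.
have over_z' := over_opposite (rel z zs) (rel z' z's) (box_pq z) (box_pq z') pz z'q
  (line_not_asc line_s z's zs).
have upP u v : u \in s -> v \in s -> desc u v -> over p q v -> over p q u.
  by move=> _ _ uv /orP[] /(descending_trans uv) uw; rewrite /over uw ?orbT.
have [u [v [us vs uv over_u nover_v]]] : exists u v,
    [/\ u \in s, v \in s, link u v, over p q u & ~~ over p q v].
  have [over_z|nover_z] := boolP (over p q z).
    by apply: (line_exit line_s zs z's) => //; rewrite over_z' over_z.
  by apply: (line_exit line_s z's zs) => //; rewrite over_z'.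
have under_v := lies_across_under (rel v vs) (box_pq v) nover_v.
by case: (no_link_past_edge uv Epq (rel u us) (rel v vs) over_u under_v).
Qed.

(* The left and right sides of the vertices are [inl] and [inr]. *)
Definition side_le (x y : V + V) : bool :=
  match x, y with
  | inl v, inr u => (u == v) || E u v
  | inr u, inl v => asc u v
  | _, _ => false
  end.

Definition sides_beyond s : {set V + V} :=
  [set x | match x with
           | inl v => right_of s v
           | inr v => right_of s v || (v \in s)
           end]%SET.

Lemma line_up_closed s : line s -> up_closed side_le (sides_beyond s).
Proof.
move=> line_s; apply/up_closedP => -[v|u] [w|w] //=; rewrite !inE.
  by case/orP=> [/eqP-> ->//|]; exact: line_separates.
by move=> uw /right_of_asc; apply.
Qed.

Lemma extents_exist : exists l r : V -> R,
  [/\ forall v, l v < r v,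
      forall u v, asc u v -> r u <= l v,
      forall u v, E u v -> l v <= r u &
      forall u v, desc u v -> E u v -> l u < r v /\ l v < r u].
Proof.
have [rank [rank_le rank_lt]] := up_closed_rank R side_le.
have strict u v s : side_le (inl u) (inr v) -> line s -> u \in s -> v \in s ->
    rank (inl u) < rank (inr v).
  move=> uv line_s us vs; apply: (rank_lt _ _ (sides_beyond s)) => //.
  - exact: line_up_closed.
  - by rewrite inE not_right_of.
  - by rewrite inE vs orbT.
exists (rank \o inl), (rank \o inr); split=> [v|u v uv|u v Euv|u v uv Euv] /=.
- have [s line_s sub_s] := line_exists (s := [:: v]) isT isT.
  have vs : v \in s by apply: sub_s; rewrite mem_head.
  by apply: (strict _ _ s); rewrite //= eqxx.
- exact: rank_le.
- by apply: rank_le; rewrite /= Euv orbT.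
have [|s line_s sub_s] := line_exists (s := [:: u; v]) isT.
  by rewrite /= andbT; apply/linkP; split=> //; exact: ncE.
have us : u \in s by apply: sub_s; rewrite mem_head.
have vs : v \in s by apply: sub_s; rewrite !inE eqxx orbT.
by split; apply: (strict _ _ s); rewrite //= ?Euv ?[E v u]E_sym ?Euv orbT.
Qed.

End Lines.

(** * Rectangles *)

Section Rectangles.
Variable R : realType.
Implicit Types (r s : rectangle R) (p q z : R * R).

Definition apart r s :=
  [|| xmax r <= xmin s, xmax s <= xmin r, ymax r <= ymin s | ymax s <= ymin r].

Definition separated r s :=
  [|| xmax r < xmin s, xmax s < xmin r, ymax r < ymin s | ymax s < ymin r].

Definition abut r s :=
  [&& xmax r == xmin s, ymin r < ymax s & ymin s < ymax r].

Definition transpose r := Rectangle (ymin_lt_ymax r) (xmin_lt_xmax r).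

Definition contact r s :=
  [|| abut r s, abut s r, abut (transpose r) (transpose s) |
      abut (transpose s) (transpose r)].

Lemma separatedC r s : separated r s = separated s r.
Proof. by rewrite /separated; lra. Qed.

Lemma contactC r s : contact r s = contact s r.
Proof. by rewrite /contact; do 2 case: abut; rewrite //= orbC. Qed.

Lemma contact_apart r s : contact r s -> apart r s.
Proof. by rewrite /contact /apart /abut /=; lra. Qed.

Lemma separated_apart r s : separated r s -> apart r s.
Proof. by rewrite /separated /apart; lra. Qed.

Lemma contact_not_separated r s : contact r s -> ~~ separated r s.
Proof.
have := (xmin_lt_xmax r, xmin_lt_xmax s, (ymin_lt_ymax r, ymin_lt_ymax s)).
by rewrite /contact /separated /abut /= => -[[? ?] [? ?]]; lra.
Qed.

Lemma apartP r s :
  apart r s <-> (rect_interior r `&` rect_interior s)%classic = classical_sets.set0.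
Proof.
split=> [apart_rs|disjoint_rs].
  apply/classical_sets.seteqP; split=> // -[x y] [[/= xr yr] [/= xs ys]].
  by move: apart_rs; rewrite /apart; lra.
apply: contraT; rewrite !negb_or -!ltNge => /and4P[srx rsx sry rsy].
have [x [x' [xx' rx sx xr xs]]] :=
  intervals_overlap (xmin_lt_xmax r) (xmin_lt_xmax s) rsx srx.
have [y [y' [yy' ry sy yr ys]]] :=
  intervals_overlap (ymin_lt_ymax r) (ymin_lt_ymax s) rsy sry.
suff : classical_sets.set0 ((x + x') / 2, (y + y') / 2) by [].
by rewrite -disjoint_rs; split; split=> /=; lra.
Qed.

Lemma rect_boundary_transpose r z :
  rect_boundary (transpose r) z -> rect_boundary r (swap_pair z).
Proof. by case=> [[? ?] not_interior]; split=> [|[? ?]] //; apply: not_interior. Qed.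

Lemma share_segment_transpose r s :
  share_segment (transpose r) (transpose s) -> share_segment r s.
Proof.
move=> [p [q [pq sub_rs]]]; exists (swap_pair p), (swap_pair q); split.
  by move=> /(can_inj swap_pairK).
move=> z [t t01 <-]; have [] := sub_rs ((1 - t) * p.1 + t * q.1, (1 - t) * p.2 + t * q.2).
  by exists t.
by move=> /rect_boundary_transpose ? /rect_boundary_transpose.
Qed.

Lemma share_segmentC r s : share_segment r s -> share_segment s r.
Proof. by move=> [p [q [pq sub_rs]]]; exists p, q; rewrite classical_sets.setIC. Qed.

Lemma abut_share_segment r s : abut r s -> share_segment r s.
Proof.
move=> /and3P[/eqP xrs yrs ysr].
have := (xmin_lt_xmax r, xmin_lt_xmax s) => -[xr xs].
have [y [y' [yy' ry sy y'r y's]]] :=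
  intervals_overlap (ymin_lt_ymax r) (ymin_lt_ymax s) yrs ysr.
exists (xmax r, y), (xmax r, y'); split=> [[e]|z [t /andP[t0 t1] <-]].
  by rewrite e ltxx in yy'.
by split; split=> [|[/=]]; rewrite /rect_closed /=; [split; nra|nra|split; nra|nra].
Qed.

Lemma contact_share_segment r s : contact r s -> share_segment r s.
Proof.
case/or4P=> /abut_share_segment // => [||/share_segmentC];
  by [exact: share_segmentC|exact: share_segment_transpose].
Qed.

Lemma segment_ends p q : segment p q p /\ segment p q q.
Proof.
case: p q => p1 p2 [q1 q2]; split; [exists 0|exists 1]; rewrite /= ?lexx ?ler01 //.
  by congr pair; ring.
by congr pair; ring.
Qed.

Lemma share_segment_contact r s : apart r s -> share_segment r s -> contact r s.
Proof.
move=> apart_rs [p [q [pq sub_rs]]]; have [seg_p seg_q] := segment_ends p q.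
have [[[/= xrp yrp] _] [[/= xsp ysp] _]] := sub_rs p seg_p.
have [[[/= xrq yrq] _] [[/= xsq ysq] _]] := sub_rs q seg_q.
have : (p.1 != q.1) || (p.2 != q.2).
  by rewrite -negb_and -xpair_eqE -!surjective_pairing; apply/eqP.
by move: apart_rs; rewrite /apart /contact /abut /=; lra.
Qed.

End Rectangles.

(** * Arrangements *)

Section Arrangements.
Variables (R : realType) (V : finType).
Implicit Types (pos : V -> R * R) (rho : V -> rectangle R) (E : rel V).

Definition arranged pos rho :=
  (forall u v, ascending (pos u) (pos v) -> xmax (rho u) <= xmin (rho v)) /\
  (forall u v, descending (pos u) (pos v) -> ymax (rho v) <= ymin (rho u)).

Definition pairwise_apart rho := forall u v, u != v -> apart (rho u) (rho v).

Section Arranged.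
Variables (pos : V -> R * R) (rho : V -> rectangle R).
Hypothesis arr : arranged pos rho.

Lemma in_box_separated u v w :
  in_box (pos u) (pos v) (pos w) -> separated (rho u) (rho v).
Proof.
rewrite /separated => /in_boxP[] [uw wv].
- by have := (arr.1 _ _ uw, arr.1 _ _ wv, xmin_lt_xmax (rho w)) => -[[]]; lra.
- by have := (arr.1 _ _ uw, arr.1 _ _ wv, xmin_lt_xmax (rho w)) => -[[]]; lra.
- by have := (arr.2 _ _ uw, arr.2 _ _ wv, ymin_lt_ymax (rho w)) => -[[]]; lra.
- by have := (arr.2 _ _ uw, arr.2 _ _ wv, ymin_lt_ymax (rho w)) => -[[]]; lra.
Qed.

Lemma corners_separated u v x y : corners (pos u) (pos v) (pos x) (pos y) ->
  (contact (rho x) (rho y) -> separated (rho u) (rho v)) /\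
  (contact (rho u) (rho v) -> separated (rho x) (rho y)).
Proof.
move=> /and4P[/arr.2 ux /arr.1 uy /arr.1 xv /arr.2 yv].
by rewrite /contact /separated /abut /=; split; lra.
Qed.

Lemma crossing_separated u v x y : contact (rho x) (rho y) ->
  crossing (pos u) (pos v) (pos x) (pos y) -> separated (rho u) (rho v).
Proof.
move=> xy; have yx : contact (rho y) (rho x) by rewrite contactC.
case/orP=> /piercesP[] /corners_separated[sep sep'].
all: by rewrite ?sep ?sep' // separatedC ?sep ?sep'.
Qed.

Lemma not_separated_admissible E u v :
    (forall x y, E x y -> contact (rho x) (rho y)) ->
  ~~ separated (rho u) (rho v) -> admissible pos E u v.
Proof.
move=> contactE not_sep; split=> [w|x y /contactE xy]; apply: contra not_sep.
  exact: in_box_separated.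
exact: crossing_separated.
Qed.

Lemma arranged_noncrossing E :
  (forall u v, E u v -> contact (rho u) (rho v)) -> noncrossing pos E.
Proof.
move=> contactE u v /contactE/contact_not_separated.
exact: not_separated_admissible.
Qed.

End Arranged.

Definition upper_left rho : rel V := fun v u =>
  [&& v != u, xmin (rho v) < xmax (rho u) & ymin (rho u) < ymax (rho v)].

(* Among the rectangles of [S] without a predecessor on their left, the highest is
   minimal: otherwise its leftmost predecessor would be such a rectangle too. *)
Lemma upper_left_minimal rho (S : {set V}) : pairwise_apart rho -> S != finset.set0 ->
  exists2 u, u \in S & {in S, forall v, ~~ upper_left rho v u}.
Proof.
move=> apart_rho /set0Pn[u0 u0S].
pose no_left u := [forall v in S, upper_left rho v u ==> (xmin (rho u) < xmax (rho v))].
have no_leftP u : reflect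
    {in S, forall v, upper_left rho v u -> xmin (rho u) < xmax (rho v)} (no_left u).
  apply: (iffP forall_inP) => left_u v vS; first exact/implyP/left_u.
  exact/implyP/left_u.
have width v := xmin_lt_xmax (rho v); have height v := ymin_lt_ymax (rho v).
have [u1 u1S leftmost] := arg_minP (fun u => xmin (rho u)) (P := mem S) u0S.
have no_left_u1 : (u1 \in S) && no_left u1.
  rewrite [u1 \in S]u1S; apply/no_leftP => v vS _.
  by apply: le_lt_trans (width v); exact: leftmost.
have [u /andP[uS /no_leftP left_u] highest] := arg_maxP (fun u => ymin (rho u))
  (P := fun u => (u \in S) && no_left u) no_left_u1.
exists u => // v0 v0S; apply/negP => ul_v0.
have [v /andP[vS ul_v] leftmost_v] := arg_minP (fun v => xmin (rho v))
  (P := fun v => (v \in S) && upper_left rho v u) (introT andP (conj v0S ul_v0)).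
have lt_uv := left_u v vS ul_v; have [vu lt_vu lt_uv'] := and3P ul_v.
have above : ymax (rho u) <= ymin (rho v).
  by have := apart_rho v u vu; rewrite /apart; lra.
suff /highest : (v \in S) && no_left v.
  by have := height u; rewrite /=; lra.
rewrite vS; apply/no_leftP => w wS /and3P[wv lt_wv lt_vw].
rewrite ltNge; apply/negP => left_w.
have [width_w height_u height_v] := And3 (width w) (height u) (height v).
have /leftmost_v : (w \in S) && upper_left rho w u.
  rewrite wS /=; apply/and3P; split; [|lra|lra].
  by apply: contraTneq left_w => ->; rewrite -ltNge.
by rewrite /=; lra.
Qed.

Lemma upper_left_extension rho : pairwise_apart rho ->
  exists2 f : V -> R, injective f & forall u v, f u < f v ->
    xmax (rho u) <= xmin (rho v) \/ ymax (rho v) <= ymin (rho u).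
Proof.
move=> apart_rho.
have [f f_inj f_lt] := linear_extension R
  (fun S => upper_left_minimal apart_rho (S := S)).
exists f => // u v fuv.
have [|lt_vu] := leP (xmax (rho u)) (xmin (rho v)); first by left.
have [|lt_uv] := leP (ymax (rho v)) (ymin (rho u)); first by right.
have vu : v != u by apply: contraTneq fuv => ->; rewrite ltxx.
by have := f_lt v u (introT and3P (And3 vu lt_vu lt_uv)); rewrite ltNge ltW.
Qed.

Definition mirror_rect (r : rectangle R) : rectangle R :=
  Rectangle (etrans (ltrN2 _ _) (xmin_lt_xmax r)) (ymin_lt_ymax r).

Lemma arrangement_exists rho : pairwise_apart rho ->
  exists2 pos : V -> R * R, general_position pos & arranged pos rho.
Proof.
move=> apart_rho.
have [f f_inj f_lt] := upper_left_extension apart_rho.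
have [|g g_inj g_lt] := @upper_left_extension (mirror_rect \o rho).
  by move=> u v /apart_rho; rewrite /apart /= !lerN2; lra.
exists (fun v => (f v, - g v)).
  by split=> [u v /f_inj|u v /oppr_inj/g_inj].
have width v := xmin_lt_xmax (rho v); have height v := ymin_lt_ymax (rho v).
split=> u v /andP[/= /f_lt left_or_above]; rewrite ltrN2 => /g_lt /=; rewrite lerN2.
  by have := (height u, height v); case: left_or_above => ? [? ?] []; lra.
by have := (width u, width v); case: left_or_above => ? [? ?] []; lra.
Qed.

Lemma layout_noncrossing E rho : irreflexive E -> rectangular_layout E rho ->
  exists2 pos : V -> R * R, general_position pos & noncrossing pos E.
Proof.
move=> E_irr [disjoint_rho share_rho].
have apart_rho : pairwise_apart rho by move=> u v /eqP/disjoint_rho/apartP.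
have [pos gpos arr] := arrangement_exists apart_rho.
exists pos => //; apply: (arranged_noncrossing arr) => u v Euv.
have uv : u != v by apply: contraTneq Euv => ->; rewrite E_irr.
by apply: share_segment_contact (apart_rho u v uv) _; apply/share_rho => //; apply/eqP.
Qed.

End Arrangements.

(** * Drawings *)

Section Convexity.
Variable R : realFieldType.
Implicit Types (s t a b c d : R) (p q x y z : R * R).

Lemma ltr_conv t a b c d : 0 <= t <= 1 -> a < c -> b < d ->
  (1 - t) * a + t * b < (1 - t) * c + t * d.
Proof.
move=> /andP[t0 t1] ac bd; have [->|tn1] := eqVneq t 1; first by lra.
have : 0 < 1 - t by rewrite subr_gt0 lt_neqAle tn1.
by nra.
Qed.

Lemma conv_lt_incr s t a b : a < b ->
  (1 - t) * a + t * b < (1 - s) * a + s * b -> t < s.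
Proof. by move=> ab lt_conv; rewrite ltNge; apply/negP => le_st; nra. Qed.

Lemma between_scaled s t a b c : 0 < t < s -> s * (b - a) = t * (c - a) -> b != a ->
  between a b c.
Proof.
move=> /andP[t0 ts] eq_st; rewrite /between.
by have [lt_ba _|lt_ab _|//] := ltgtP b a; [apply/orP; right|apply/orP; left]; nra.
Qed.

Definition orient p q z := (q.1 - p.1) * (z.2 - p.2) - (q.2 - p.2) * (z.1 - p.1).

End Convexity.

Section Segments.
Variable R : realType.
Implicit Types p q x y z : R * R.

Lemma segmentC p q z : segment p q z -> segment q p z.
Proof.
case=> t /andP[t0 t1] <-; exists (1 - t); first by apply/andP; split; lra.
by congr pair; ring.
Qed.

Lemma segment_mirror p q z :
  segment p q z -> segment (mirror p) (mirror q) (mirror z).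
Proof. by case=> t t01 <-; exists t => //; congr pair => /=; ring. Qed.

Lemma segment_ascending p q z : ascending p q -> segment p q z ->
  [/\ p.1 <= z.1, z.1 <= q.1, p.2 <= z.2 & z.2 <= q.2].
Proof. by case/andP=> pq1 pq2 [t /andP[t0 t1] <-] /=; split; nra. Qed.

Lemma segment_descending p q z : descending p q -> segment p q z ->
  [/\ p.1 <= z.1, z.1 <= q.1, q.2 <= z.2 & z.2 <= p.2].
Proof. by case/andP=> pq1 pq2 [t /andP[t0 t1] <-] /=; split; nra. Qed.

Lemma parallel_segments_disjoint p q x y z :
    ascending p q -> ascending x y -> descending p x -> descending q y ->
  segment p q z -> ~ segment x y z.
Proof.
case/andP=> pq1 pq2 _ /andP[px1 px2] /andP[qy1 qy2] [s s01 <-] [t t01 [eq1 eq2]].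
have := ltr_conv t01 px1 qy1; have := ltr_conv t01 px2 qy2; rewrite eq1 eq2.
by move=> /(conv_lt_incr pq2) lt_st /(conv_lt_incr pq1); rewrite ltNge ltW.
Qed.

Lemma segments_meet p q x y : orient p q x < 0 < orient p q y ->
  orient x y q < 0 < orient x y p -> exists z, segment p q z /\ segment x y z.
Proof.
case/andP=> x_neg y_pos /andP[q_neg p_pos].
have eq_orient : orient p q y - orient p q x = orient x y p - orient x y q.
  by rewrite /orient; ring.
pose d := orient p q y - orient p q x; have d0 : 0 < d by rewrite /d; lra.
have dn0 : d != 0 by rewrite gt_eqF.
have ratio01 a : 0 < a < d -> 0 <= a / d <= 1.
  by case/andP=> a0 ad; rewrite divr_ge0 ?(ltW a0) ?(ltW d0) //= ler_pdivrMr // mul1r ltW.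
pose s := orient x y p / d; pose t := - orient p q x / d.
exists ((1 - s) * p.1 + s * q.1, (1 - s) * p.2 + s * q.2); split.
  by exists s => //; apply: ratio01; rewrite /d eq_orient; lra.
exists t; first by apply: ratio01; rewrite /d; lra.
by congr pair; rewrite /s /t; move: dn0; rewrite /d /orient => ?; field.
Qed.

Lemma corners_segments_meet p q x y : corners p q x y ->
  exists z, segment p q z /\ segment x y z.
Proof.
rewrite /corners /ascending /descending.
case/and4P=> /andP[px1 px2] /andP[py1 py2] /andP[xq1 xq2] /andP[yq1 yq2].
by apply: segments_meet; rewrite /orient; apply/andP; split; nra.
Qed.

End Segments.

Definition vertex_disjoint (V : eqType) (u v x y : V) :=
  [/\ u != x, u != y, v != x & v != y].

Section NoncrossingDrawing.
Variables (R : realType) (V : finType) (pos : V -> R * R) (E : rel V).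
Hypotheses (E_sym : symmetric E) (E_irr : irreflexive E).
Hypotheses (gpos : general_position pos) (ncE : noncrossing pos E).

Local Notation asc u v := (ascending (pos u) (pos v)).
Local Notation desc u v := (descending (pos u) (pos v)).
Local Notation box u v w := (in_box (pos u) (pos v) (pos w)).

Lemma noncrossing_weak_closed_RI : weak_closed_RI_drawing E pos.
Proof.
split=> [u v uv|u v Euv w]; first by apply: gpos.1; rewrite uv.
have [->|wu] := eqVneq w u; first by left.
have [->|wv] := eqVneq w v; first by right.
have [/(_ w) box_w _] := ncE Euv; case=> in1 in2; exfalso.
move: (coordinates_neq gpos wu) (coordinates_neq gpos wv) box_w in1 in2.
rewrite /in_box /between /Num.min /Num.max.
by do 2 case: ifP => ?; lra.
Qed.

Lemma x_le_cases u v : u != v -> (pos u).1 <= (pos v).1 -> asc u v \/ desc u v.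
Proof.
move=> /(general_position_cases gpos)[] uv le_uv; [by left| |by right|];
  by move: uv; rewrite /ascending /descending; lra.
Qed.

Lemma y_le_cases u v : u != v -> (pos u).2 <= (pos v).2 -> asc u v \/ desc v u.
Proof.
move=> /(general_position_cases gpos)[] uv le_uv; [by left| | |by right];
  by move: uv; rewrite /ascending /descending; lra.
Qed.

Lemma le_ascending u v : u != v ->
  (pos u).1 <= (pos v).1 -> (pos u).2 <= (pos v).2 -> asc u v.
Proof.
move=> uv /(x_le_cases uv)[//|uv' le2].
by move: uv'; rewrite /descending; lra.
Qed.

Lemma edges_not_corners u v x y : E u v -> E x y ->
  ~ corners (pos u) (pos v) (pos x) (pos y).
Proof.
move=> Euv Exy /corners_pierces pierced; have [_ /(_ x y Exy)/negP] := ncE Euv.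
by apply; apply/orP; left.
Qed.

Section DisjointEdges.
Variables u v x y : V.
Hypotheses (Euv : E u v) (Exy : E x y).
Hypothesis neq_ends : vertex_disjoint u v x y.

Let box_uv w : ~ box u v w.
Proof. by have [/(_ w)/negP] := ncE Euv. Qed.

Let box_xy w : ~ box x y w.
Proof. by have [/(_ w)/negP] := ncE Exy. Qed.

Lemma ascending_ascending_disjoint z : asc u v -> asc x y ->
  segment (pos u) (pos v) z -> ~ segment (pos x) (pos y) z.
Proof.
move=> uv xy seg_uv seg_xy; have [ux uy vx vy] := neq_ends.
have [uz1 zv1 uz2 zv2] := segment_ascending uv seg_uv.
have [xz1 zy1 xz2 zy2] := segment_ascending xy seg_xy.
have asc_uy : asc u y by apply: le_ascending uy _ _; lra.
have asc_xv : asc x v by rewrite eq_sym in vx; apply: le_ascending vx _ _; lra.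
have {}ux : desc u x \/ desc x u.
  case: (general_position_cases gpos ux) => [ux'|xu|xu|ux']; [| |by left|by right].
    by case: (@box_uv x); exact: ascending_in_box.
  by case: (@box_xy u); exact: ascending_in_box.
have {}vy : desc v y \/ desc y v.
  case: (general_position_cases gpos vy) => [vy'|yv|vy'|yv]; [| |by left|by right].
    by case: (@box_xy v); exact: ascending_in_box.
  by case: (@box_uv y); exact: ascending_in_box.
case: ux vy => [ux|xu] [vy|yv].
- exact: parallel_segments_disjoint uv xy ux vy seg_uv seg_xy.
- by apply: (edges_not_corners Euv Exy); apply/and4P.
- by apply: (edges_not_corners Exy Euv); apply/and4P.
- exact: parallel_segments_disjoint xy uv xu yv seg_xy seg_uv.
Qed.

Lemma ascending_descending_disjoint z : asc u v -> desc x y ->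
  segment (pos u) (pos v) z -> ~ segment (pos x) (pos y) z.
Proof.
move=> uv xy seg_uv seg_xy; have [ux uy vx vy] := neq_ends.
have [uz1 zv1 uz2 zv2] := segment_ascending uv seg_uv.
have [xz1 zy1 yz2 zx2] := segment_descending xy seg_xy.
have {}ux : asc u x \/ desc x u by apply: y_le_cases => //; lra.
have {}uy : asc u y \/ desc u y by apply: x_le_cases => //; lra.
have {}vx : asc x v \/ desc x v by apply: x_le_cases; [rewrite eq_sym|lra].
have {}vy : asc y v \/ desc v y by apply: y_le_cases; [rewrite eq_sym|lra].
case: ux => [ux|xu].
  have {}vx : desc x v by case: vx => // xv; case: (@box_uv x); exact: ascending_in_box.
  have {}vy : asc y v by case: vy => // vy; case: (@box_xy v); exact: descending_in_box.
  have {}uy : desc u y by case: uy => // uy; case: (@box_uv y); exact: ascending_in_box.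
  by apply: (edges_not_corners Euv); first rewrite E_sym; [exact: Exy|apply/and4P].
have {}uy : asc u y by case: uy => // uy; case: (@box_xy u); exact: descending_in_box.
have {}vy : desc v y by case: vy => // yv; case: (@box_uv y); exact: ascending_in_box.
have {}vx : asc x v by case: vx => // xv; case: (@box_xy v); exact: descending_in_box.
by apply: (edges_not_corners Exy Euv); apply/and4P.
Qed.

End DisjointEdges.

Lemma edge_neq u v : E u v -> u != v.
Proof. by apply: contraTneq => ->; rewrite E_irr. Qed.

Lemma star_segments u v w z : E u v -> E u w -> v != w ->
  segment (pos u) (pos v) z -> segment (pos u) (pos w) z -> z = pos u.
Proof.
move=> Euv Euw vw [s /andP[s0 s1] <-] [t /andP[t0 t1] /= [eq1 eq2]].
have {}eq1 : s * ((pos v).1 - (pos u).1) = t * ((pos w).1 - (pos u).1) by lra.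
have {}eq2 : s * ((pos v).2 - (pos u).2) = t * ((pos w).2 - (pos u).2) by lra.
have /andP[vu1 vu2] : ((pos v).1 != (pos u).1) && ((pos v).2 != (pos u).2).
  by apply: (coordinates_neq gpos); rewrite eq_sym edge_neq.
have /andP[wu1 wu2] : ((pos w).1 != (pos u).1) && ((pos w).2 != (pos u).2).
  by apply: (coordinates_neq gpos); rewrite eq_sym edge_neq.
have [->|s_neq0] := eqVneq s 0.
  by case: (pos u) => u1 u2; congr pair; rewrite /=; ring.
have t_neq0 : t != 0.
  apply: contraNneq s_neq0 => t_eq0; move/eqP: eq1; rewrite t_eq0 mul0r mulf_eq0.
  by rewrite subr_eq0 (negPf vu1) orbF.
have [s_gt0 t_gt0] : 0 < s /\ 0 < t.
  by split; rewrite lt_neqAle eq_sym ?s_neq0 ?t_neq0.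
have [lt_ts|lt_st|eq_ts] := ltgtP t s.
- have [/(_ v)/negP[]] := ncE Euw; apply/andP.
  by split; apply: (@between_scaled _ s t); rewrite ?t_gt0.
- have [/(_ w)/negP[]] := ncE Euv; apply/andP.
  by split; apply: (@between_scaled _ t s); rewrite ?s_gt0.
- move: eq1; rewrite eq_ts => /(mulfI s_neq0)/addIr/gpos.1 eq_vw.
  by rewrite eq_vw eqxx in vw.
Qed.

Lemma ascending_edge_disjoint u v x y z : asc u v -> E u v -> E x y ->
    vertex_disjoint u v x y ->
  segment (pos u) (pos v) z -> ~ segment (pos x) (pos y) z.
Proof.
move=> uv Euv Exy neq_ends seg_uv seg_xy.
have Eyx : E y x by rewrite E_sym.
have seg_yx := segmentC seg_xy.
have neq_ends' : vertex_disjoint u v y x by case: neq_ends.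
case: (general_position_cases gpos (edge_neq Exy)) => [xy|yx|xy|yx].
- exact: (ascending_ascending_disjoint Euv Exy neq_ends uv xy seg_uv seg_xy).
- exact: (ascending_ascending_disjoint Euv Eyx neq_ends' uv yx seg_uv seg_yx).
- exact: (ascending_descending_disjoint Euv Exy neq_ends uv xy seg_uv seg_xy).
- exact: (ascending_descending_disjoint Euv Eyx neq_ends' uv yx seg_uv seg_yx).
Qed.

End NoncrossingDrawing.

Section PlanarDrawing.
Variables (R : realType) (V : finType) (pos : V -> R * R) (E : rel V).
Hypotheses (E_sym : symmetric E) (E_irr : irreflexive E).
Hypotheses (gpos : general_position pos) (ncE : noncrossing pos E).

Lemma vertex_disjoint_segments_disjoint u v x y z :
    E u v -> E x y -> vertex_disjoint u v x y ->
  segment (pos u) (pos v) z -> ~ segment (pos x) (pos y) z.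
Proof.
move=> Euv Exy neq_ends seg_uv seg_xy.
have Evu : E v u by rewrite E_sym.
have neq_ends' : vertex_disjoint v u x y by case: neq_ends.
have seg_vu := segmentC seg_uv.
have mirrored := ascending_edge_disjoint E_sym E_irr (general_position_mirror gpos)
  (noncrossing_mirror ncE).
case: (general_position_cases gpos (edge_neq E_irr Euv)) => [uv|vu|uv|vu].
- exact: (ascending_edge_disjoint E_sym E_irr gpos ncE uv Euv Exy neq_ends seg_uv).
- exact: (ascending_edge_disjoint E_sym E_irr gpos ncE vu Evu Exy neq_ends' seg_vu).
- apply: (mirrored v u x y (mirror z)) => //; rewrite /= ?ascending_mirror //;
    exact: segment_mirror.
- apply: (mirrored u v x y (mirror z)) => //; rewrite /= ?ascending_mirror //;
    exact: segment_mirror.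
Qed.

Lemma noncrossing_planar : planar_drawing E pos.
Proof.
move=> u v x y Euv Exy neq_edges z [seg_uv seg_xy].
have star := star_segments E_irr gpos ncE.
have [Evu Eyx] : E v u /\ E y x by split; rewrite E_sym.
have seg_vu := segmentC seg_uv; have seg_yx := segmentC seg_xy.
have [xu|ux] := eqVneq u x.
  exists u; first by rewrite xu; split; left.
  rewrite -xu in Exy seg_xy; apply/esym/(star _ _ _ _ Euv Exy) => //.
  by apply/eqP => vy; case: neq_edges; rewrite xu vy.
have [yu|uy] := eqVneq u y.
  exists u; first by split; [left|right].
  rewrite -yu in Eyx seg_yx; apply/esym/(star _ _ _ _ Euv Eyx) => //.
  by apply/eqP => vx; case: neq_edges; rewrite yu vx classical_sets.setUC.
have [xv|vx] := eqVneq v x.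
  exists v; first by split; [right|left].
  by rewrite -xv in Exy seg_xy; apply/esym/(star _ _ _ _ Evu Exy).
have [yv|vy] := eqVneq v y.
  exists v; first by split; right.
  by rewrite -yv in Eyx seg_yx; apply/esym/(star _ _ _ _ Evu Eyx).
by case: (vertex_disjoint_segments_disjoint Euv Exy (And4 ux uy vx vy) seg_uv).
Qed.

Lemma noncrossing_drawing : has_planar_weak_closed_RI_drawing R E.
Proof.
exists pos; split; last exact: noncrossing_planar.
exact: noncrossing_weak_closed_RI.
Qed.

End PlanarDrawing.

Section DrawingNoncrossing.
Variables (R : realType) (V : finType) (E : rel V) (pos : V -> R * R).
Hypotheses (E_sym : symmetric E) (weakE : weak_closed_RI_drawing E pos).
Hypothesis planarE : planar_drawing E pos.

Lemma planar_edges_not_corners u v x y : E u v -> E x y ->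
    vertex_disjoint u v x y ->
  ~~ corners (pos u) (pos v) (pos x) (pos y).
Proof.
move=> Euv Exy [ux uy vx vy]; apply/negP => /corners_segments_meet[z [seg_uv seg_xy]].
have [|w [wuv wxy] _] := planarE Euv Exy _ (conj seg_uv seg_xy).
  move=> eq_edges; have : ([set x; y] : set V)%classic u by rewrite -eq_edges; left.
  by case=> eq_u; [move: ux|move: uy]; rewrite eq_u eqxx.
by move: ux uy vx vy; case: wuv => <-; case: wxy => <-; rewrite eqxx.
Qed.

Definition refines (pos' : V -> R * R) := forall u v,
  ((pos u).1 < (pos v).1 -> (pos' u).1 < (pos' v).1) /\
  ((pos u).2 < (pos v).2 -> (pos' u).2 < (pos' v).2).

Lemma refinement_exists : exists2 pos', general_position pos' & refines pos'.
Proof.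
have [f f_inj f_lt] := injective_rank R (fun v => (pos v).1).
have [g g_inj g_lt] := injective_rank R (fun v => (pos v).2).
exists (fun v => (f v, g v)); first by split.
by move=> u v; split; [exact: f_lt|exact: g_lt].
Qed.

Lemma edge_excludes u v w : E u v -> w != u -> w != v ->
  ~~ ((Num.min (pos u).1 (pos v).1 <= (pos w).1 <= Num.max (pos u).1 (pos v).1) &&
      (Num.min (pos u).2 (pos v).2 <= (pos w).2 <= Num.max (pos u).2 (pos v).2)).
Proof.
move=> Euv wu wv; apply/negP => /andP w_in.
by have [] := weakE.2 u v Euv w w_in; apply/eqP.
Qed.

Section Refinement.
Variable pos' : V -> R * R.
Hypothesis refined : refines pos'.

Let x_le u v : (pos' u).1 < (pos' v).1 -> (pos u).1 <= (pos v).1.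
Proof. by apply: contraTT; rewrite -ltNge -leNgt => /(refined v u).1/ltW. Qed.

Let y_le u v : (pos' u).2 < (pos' v).2 -> (pos u).2 <= (pos v).2.
Proof. by apply: contraTT; rewrite -ltNge -leNgt => /(refined v u).2/ltW. Qed.

Lemma refinement_box_empty u v w : E u v -> ~~ in_box (pos' u) (pos' v) (pos' w).
Proof.
move=> Euv; have [->|wu] := eqVneq w u; first by rewrite /in_box /between; lra.
have [->|wv] := eqVneq w v; first by rewrite /in_box /between; lra.
apply: contra (edge_excludes Euv wu wv); rewrite /in_box /between !ge_min !le_max.
by case/andP=> /orP[]/andP[/x_le-> /x_le->] /orP[]/andP[/y_le-> /y_le->]; rewrite ?orbT.
Qed.

(* The corners in [pos'] give weak inequalities in [pos]. An equality would put an
   end of one edge into the closed rectangle of the other. *)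
Lemma refinement_not_corners u v x y : E u v -> E x y ->
  ~~ corners (pos' u) (pos' v) (pos' x) (pos' y).
Proof.
move=> Euv Exy; apply/negP; rewrite /corners /ascending /descending.
move=> /and4P[/andP[ux1 xu2] /andP[uy1 uy2] /andP[xv1 xv2] /andP[yv1 vy2]].
have [ux uy vx vy] : vertex_disjoint u v x y.
  by split; [move: ux1|move: uy1|move: xv1|move: yv1];
     apply: contraTneq => ->; rewrite ltxx.
have := planar_edges_not_corners Euv Exy (And4 ux uy vx vy); apply/negP.
have [xu xv yu yv] : vertex_disjoint x y u v.
  by split; rewrite eq_sym.
have := edge_excludes Exy ux uy; have := edge_excludes Exy vx vy.
have := edge_excludes Euv xu xv; have := edge_excludes Euv yu yv.
move: (x_le ux1) (y_le xu2) (x_le uy1) (y_le uy2).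
move: (x_le xv1) (y_le xv2) (x_le yv1) (y_le vy2).
by rewrite !ge_min !le_max /corners /ascending /descending; lra.
Qed.

Lemma refinement_noncrossing : noncrossing pos' E.
Proof.
apply: noncrossing_corners => //; [exact: refinement_box_empty|].
exact: refinement_not_corners.
Qed.

End Refinement.

End DrawingNoncrossing.

Lemma drawing_noncrossing (R : realType) (V : finType) (E : rel V) :
    symmetric E -> has_planar_weak_closed_RI_drawing R E ->
  exists2 pos : V -> R * R, general_position pos & noncrossing pos E.
Proof.
move=> E_sym [pos [weakE planarE]]; have [pos' gpos' refined] := refinement_exists pos.
by exists pos' => //; exact: refinement_noncrossing refined.
Qed.

(** * From noncrossing positions to layouts *)

Section Saturation.
Variables (R : realDomainType) (V : finType) (pos : V -> R * R).
Implicit Types E F : rel V.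

Definition add_edge E u v : rel V :=
  fun x y => [|| (x, y) == (u, v), (x, y) == (v, u) | E x y].

Lemma noncrossing_add_edge E u v :
  noncrossing pos E -> admissible pos E u v -> noncrossing pos (add_edge E u v).
Proof.
move=> ncE adm_uv.
have adm x y : add_edge E u v x y -> admissible pos E x y.
  case/or3P=> [/eqP[-> ->]//|/eqP[-> ->]|/ncE//].
  exact: admissibleC.
move=> x y xy; have [box_xy cross_xy] := adm x y xy; split=> // x' y' xy'.
have [_ cross_xy'] := adm x' y' xy'.
have [/cross_xy//|nE'] := boolP (E x' y').
have [/cross_xy'|nE] := boolP (E x y); first by rewrite crossingC.
move: xy xy'; rewrite /add_edge (negPf nE) (negPf nE') !orbF.
case/orP=> /eqP[-> ->] /orP[] /eqP[-> ->].
- by rewrite crossing_refl.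
- by rewrite crossingCl crossing_refl.
- by rewrite crossingCl crossing_refl.
- by rewrite crossing_refl.
Qed.

Lemma saturation_exists E : symmetric E -> irreflexive E -> noncrossing pos E ->
  exists F : rel V, [/\ symmetric F, irreflexive F, noncrossing pos F, subrel E F &
    forall u v, u != v -> admissible pos F u v -> F u v].
Proof.
move=> E_sym E_irr ncE; pose edge (A : {set V * V}) u v := (u, v) \in A.
pose P A :=
  `[< [/\ symmetric (edge A), irreflexive (edge A) & noncrossing pos (edge A)] >].
have PE : P [set e | E e.1 e.2]%SET.
  apply/asboolP; suff -> : edge [set e | E e.1 e.2]%SET = E by [].
  by apply/funext => u; apply/funext => v; rewrite /edge inE.
have [A /maxsetP[/asboolP[symA irrA ncA] maxA] /fintype.subsetP EA] := maxset_exists PE.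
exists (edge A); split=> // [u v Euv|u v uv adm]; first by apply: EA; rewrite inE.
have add_uv : edge ((u, v) |: ((v, u) |: A))%SET = add_edge (edge A) u v.
  by apply/funext => x; apply/funext => y; rewrite /edge !inE.
have PA' : P ((u, v) |: ((v, u) |: A))%SET.
  apply/asboolP; rewrite add_uv; split=> [x y|x|].
  - by rewrite /add_edge symA !xpair_eqE orbCA ![(y == _) && _]andbC.
  - apply: contraNF uv; rewrite /add_edge irrA orbF !xpair_eqE.
    by case/orP=> /andP[/eqP<- /eqP<-].
  - exact: noncrossing_add_edge.
rewrite /edge -(maxA _ PA') ?setU11 //.
by apply/fintype.subsetP => e eA; rewrite !inE eA !orbT.
Qed.

End Saturation.

Section StrictLayouts.
Variables (R : realType) (V : finType).
Implicit Types (pos : V -> R * R) (rho : V -> rectangle R) (E F : rel V).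

Definition strict_layout E rho := forall u v, u != v ->
  if E u v then contact (rho u) (rho v) else separated (rho u) (rho v).

Lemma strict_layout_apart E rho : strict_layout E rho -> pairwise_apart rho.
Proof.
move=> strict u v /strict.
by case: ifP => _; [exact: contact_apart|exact: separated_apart].
Qed.

Lemma strict_layout_contact_graph E rho :
  strict_layout E rho -> rectangle_contact_graph R E.
Proof.
move=> strict; have apart_rho := strict_layout_apart strict.
exists rho; split=> u v /eqP uv; first exact/apartP/apart_rho.
split=> [share|Euv].
  have touching := share_segment_contact (apart_rho u v uv) share.
  have := strict u v uv; case: ifP => // _.
  by rewrite (negPf (contact_not_separated touching)).
by apply: contact_share_segment; have := strict u v uv; rewrite Euv.
Qed.

Lemma arranged_contacts_exist pos E : general_position pos ->
    symmetric E -> irreflexive E -> noncrossing pos E ->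
  exists2 rho, arranged pos rho & forall u v, E u v -> contact (rho u) (rho v).
Proof.
move=> gpos E_sym E_irr ncE.
have [l [r [lr lr_asc lrE lr_desc]]] := extents_exist gpos E_sym ncE.
have [b [t [bt bt_asc btE bt_desc]]] :=
  extents_exist (general_position_mirror gpos) E_sym (noncrossing_mirror ncE).
exists (fun v => Rectangle (lr v) (bt v)).
  by split=> [|u v] /=; [exact: lr_asc|rewrite -ascending_mirror; exact: bt_asc].
move=> u v Euv; have Evu : E v u by rewrite E_sym.
have uv : u != v by apply: contraTneq Euv => ->; rewrite E_irr.
rewrite /contact /abut /= !eq_le !(lrE, btE) // !andbT.
case: (general_position_cases gpos uv) => dir.
- have [||bt_uv bt_vu] := bt_desc v u; rewrite /= ?descending_mirror //.
  by rewrite (lr_asc u v) // bt_uv bt_vu.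
- have [||bt_uv bt_vu] := bt_desc u v; rewrite /= ?descending_mirror //.
  by rewrite (lr_asc v u) // bt_uv bt_vu !orbT.
- have [lr_uv lr_vu] := lr_desc u v dir Euv.
  by rewrite (bt_asc v u) /= ?ascending_mirror // lr_uv lr_vu !orbT.
- have [lr_uv lr_vu] := lr_desc v u dir Evu.
  by rewrite (bt_asc u v) /= ?ascending_mirror // lr_uv lr_vu !orbT.
Qed.

Lemma saturated_strict_layout pos E : general_position pos ->
    symmetric E -> irreflexive E -> noncrossing pos E ->
    (forall u v, u != v -> admissible pos E u v -> E u v) ->
  exists rho, strict_layout E rho.
Proof.
move=> gpos E_sym E_irr ncE saturated.
have [rho arr contactE] := arranged_contacts_exist gpos E_sym E_irr ncE.
exists rho => u v uv; have [/contactE//|nEuv] := boolP (E u v).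
apply: contraNT nEuv => not_sep; apply: saturated => //.
exact: not_separated_admissible not_sep.
Qed.

(* Contacts along a common vertical line form a path. Cutting it at the contact of
   [a] and [c] leaves two pieces, and [moving_right], [moving_left] select the right
   and left sides in the piece of [c]: the sides above the contact belong to it if
   [c] reaches at least as high as [a], and similarly below. *)
Definition moving_right rho a c u :=
  [&& xmax (rho u) == xmax (rho a), u != a &
      if ymax (rho a) <= ymin (rho u) then ymax (rho a) <= ymax (rho c)
      else ymin (rho c) <= ymin (rho a)].

Definition moving_left rho a c v :=
  (xmin (rho v) == xmin (rho c)) &&
  ((v == c) || if ymax (rho c) <= ymin (rho v) then ymax (rho a) <= ymax (rho c)
               else ymin (rho c) <= ymin (rho a)).

Lemma moving_abut rho a c u v : pairwise_apart rho ->
    abut (rho a) (rho c) -> abut (rho u) (rho v) ->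
  moving_left rho a c v = (moving_right rho a c u + ((u, v) == (a, c)))%N :> nat.
Proof.
move=> apart_rho /and3P[/eqP ac ac_y ca_y] /and3P[/eqP uv uv_y vu_y].
have width w := xmin_lt_xmax (rho w).
rewrite /moving_left /moving_right -uv -ac xpair_eqE.
have [line_u|off_line] /= := eqVneq (xmax (rho u)) (xmax (rho a)); last first.
  by case: (eqVneq u a) off_line => [->|//]; rewrite eqxx.
have ua_y : u != a -> (ymax (rho u) <= ymin (rho a)) || (ymax (rho a) <= ymin (rho u)).
  by move/apart_rho; have := (width u, width a); rewrite /apart => -[? ?]; lra.
have vc_y : v != c -> (ymax (rho v) <= ymin (rho c)) || (ymax (rho c) <= ymin (rho v)).
  by move/apart_rho; have := (width v, width c); rewrite /apart => -[? ?]; lra.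
have [eq_ua|ua] := eqVneq u a; have [eq_vc|vc] := eqVneq v c; rewrite //= ?addn0.
- rewrite eq_ua in uv_y vu_y; have {}vc_y := vc_y vc.
  by case: leP => ?; apply/eqP; rewrite eqb0 -ltNge; lra.
- rewrite eq_vc in uv_y vu_y; have {}ua_y := ua_y ua.
  by case: leP => ?; apply/esym/eqP; rewrite eqb1; lra.
- have {}ua_y := ua_y ua; have {}vc_y := vc_y vc.
  case: (leP (ymax (rho a)) (ymin _)) => ?; case: (leP (ymax (rho c)) (ymin _)) => ? //;
    by exfalso; lra.
Qed.

Lemma abut_speeds rho (D : rel V) : pairwise_apart rho ->
  exists sl sr : V -> nat,
    forall u v, abut (rho u) (rho v) -> sl v = (sr u + D u v)%N.
Proof.
move=> apart_rho; pose cuts (e : V * V) := abut (rho e.1) (rho e.2) && D e.1 e.2.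
exists (fun v => \sum_(e | cuts e) moving_left rho e.1 e.2 v)%N.
exists (fun u => \sum_(e | cuts e) moving_right rho e.1 e.2 u)%N => u v uv.
rewrite (eq_bigr (fun e => moving_right rho e.1 e.2 u + ((u, v) == e))%N); last first.
  by case=> a c /andP[ac _]; exact: moving_abut.
rewrite big_split /=; congr (_ + _)%N; have [Duv|nDuv] := boolP (D u v).
  rewrite (bigD1 (u, v)) /cuts /= ?uv // eqxx big1 // => e /andP[_].
  by rewrite eq_sym => /negPf->.
rewrite big1 // => e /andP[_ De]; case: eqP => // eq_e.
by rewrite -eq_e (negPf nDuv) in De.
Qed.

(* The new coordinate of a side is the rank of its old coordinate, ties being broken
   by its speed. *)
Lemma cut_abutments rho (D : rel V) : pairwise_apart rho ->
  exists l r : V -> R,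
    [/\ forall u v, xmin (rho u) < xmax (rho v) -> l u < r v,
        forall u v, xmax (rho u) < xmin (rho v) -> r u < l v &
        forall u v, abut (rho u) (rho v) -> if D u v then r u < l v else r u == l v].
Proof.
move=> apart_rho; have [sl [sr speeds]] := abut_speeds D apart_rho.
pose side (x : V + V) : R *l nat :=
  match x with inl v => (xmin (rho v), sl v) | inr v => (xmax (rho v), sr v) end.
have [rank rank_le] := rank_embedding R side.
have rank_lt x y : (rank x < rank y) = (side x < side y)%O by rewrite !ltNge rank_le.
exists (rank \o inl), (rank \o inr); split=> [u v uv|u v uv|u v abut_uv] /=.
- by rewrite rank_lt /= ltxi_pair ltW // leNgt uv.
- by rewrite rank_lt /= ltxi_pair ltW // leNgt uv.
have [/eqP uv _] := andP abut_uv; case: (D u v) (speeds u v abut_uv) => speed_uv.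
  by rewrite rank_lt /= ltxi_pair uv lexx /= speed_uv addn1 ltEnat /=.
by rewrite eq_le !rank_le /= !lexi_pair uv lexx speed_uv addn0 lexx.
Qed.

Lemma strict_sublayout E F rho : symmetric E -> subrel E F -> strict_layout F rho ->
  exists rho', strict_layout E rho'.
Proof.
move=> E_sym EF strict; have apart_rho := strict_layout_apart strict.
pose nonedge u v := ~~ E u v.
have [l [r [lr rl abut_lr]]] := cut_abutments nonedge apart_rho.
have [|b [t [bt tb abut_bt]]] := @cut_abutments (@transpose R \o rho) nonedge.
  by move=> u v /apart_rho; rewrite /apart /=; lra.
pose rho' v := Rectangle (lr v v (xmin_lt_xmax _)) (bt v v (ymin_lt_ymax _)).
have abut_x u v : abut (rho u) (rho v) ->
    if E u v then abut (rho' u) (rho' v) else separated (rho' u) (rho' v).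
  move=> uv; have := abut_lr u v uv; rewrite /nonedge /separated /abut /=.
  by case: (E u v) => /= [/eqP->|->//]; case/and3P: uv => _ /bt-> /bt->; rewrite eqxx.
have abut_y u v : abut (transpose (rho u)) (transpose (rho v)) ->
    if E u v then abut (transpose (rho' u)) (transpose (rho' v))
    else separated (rho' u) (rho' v).
  move=> uv; have := abut_bt u v uv; rewrite /nonedge /separated /abut /=.
  by case: (E u v) => /= [/eqP->|->]; rewrite ?orbT //;
     case/and3P: uv => _ /lr-> /lr->; rewrite eqxx.
have contact_xy u v : contact (rho u) (rho v) ->
    if E u v then contact (rho' u) (rho' v) else separated (rho' u) (rho' v).
  case/or4P=> [/abut_x|/abut_x|/abut_y|/abut_y]; rewrite ?[E v u]E_sym /contact;
    by case: (E u v) => [->|]; rewrite ?orbT // separatedC.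
exists rho' => u v uv; have := strict u v uv.
have [_ /contact_xy//|nFuv] := boolP (F u v).
rewrite (contraNF (EF u v) nFuv) /separated /=.
by case/or4P=> [/rl|/rl|/tb|/tb] ->; rewrite ?orbT.
Qed.

End StrictLayouts.

Lemma noncrossing_contact_graph (R : realType) (V : finType) (E : rel V)
    (pos : V -> R * R) :
    symmetric E -> irreflexive E -> general_position pos -> noncrossing pos E ->
  rectangle_contact_graph R E.
Proof.
move=> E_sym E_irr gpos ncE.
have [F [F_sym F_irr ncF EF saturated]] := saturation_exists E_sym E_irr ncE.
have [rho strictF] := saturated_strict_layout gpos F_sym F_irr ncF saturated.
have [rho' strictE] := strict_sublayout E_sym EF strictF.
exact: strict_layout_contact_graph strictE.
Qed.

Theorem theorem3 (R : realType) (V : finType) (E : rel V)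
    (E_sym : symmetric E) (E_irr : irreflexive E)
    (E_connected : forall u v : V, connect E u v)
    (V_card : (4 <= #|V|)%N) :
  rectangle_contact_graph R E <-> has_planar_weak_closed_RI_drawing R E.
Proof.
split=> [[rho layout]|drawing].
  have [pos gpos ncE] := layout_noncrossing E_irr layout.
  exact: noncrossing_drawing E_sym E_irr gpos ncE.
have [pos gpos ncE] := drawing_noncrossing E_sym drawing.
exact: noncrossing_contact_graph E_sym E_irr gpos ncE.
Qed.
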